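(* Let $\mathcal{P}$ be a PTRS that is orthogonal and right-linear (equivalently: non-overlapping and linear). Then for each $X \in \{\mathtt{AST}, \mathtt{PAST}, \mathtt{SAST}\}$ we have: $X(\xrightarrow{\mathbf{f}}_{\mathcal{P}})$ holds if and only if $X(\xrightarrow{\mathbf{i}}_{\mathcal{P}})$ holds.
   Context: Terms $\mathcal{T}$ are built from a countable signature $\Sigma$ and countable variable set $\mathcal{V}$. A finite multi-distribution on a set $A\neq\emptyset$ is a finite multiset $\mu$ of pairs $(p:a)$ with $0<p\le 1$, $a\in A$, whose probabilities sum to $1$; $\mathrm{FDist}(A)$ is the set of these, $\mathrm{Supp}(\mu)$ the multiset of the $a$'s, and $p\cdot\mu=\{(p\cdot q:a)\mid (q:a)\in\mu\}$. A probabilistic rewrite rule is $\ell\to\mu$ with $\ell\in\mathcal{T}\setminus\mathcal{V}$, $\mu\in\mathrm{FDist}(\mathcal{T})$ and $\mathcal{V}(r)\subseteq\mathcal{V}(\ell)$ for all $r\in\mathrm{Supp}(\mu)$; a PTRS is a countable set $\mathcal{P}$ of such rules. Full rewriting: $s\xrightarrow{\mathbf{f}}_{\mathcal{P}}\{p_1:t_1,\dots,p_k:t_k\}$ iff there are a position $\pi$ of $s$, a rule $\ell\to\{p_1:r_1,\dots,p_k:r_k\}\in\mathcal{P}$ and a substitution $\sigma$ with $s|_\pi=\ell\sigma$ and $t_j=s[r_j\sigma]_\pi$ for all $j$. A term is a normal form if no such step applies to it. The step is innermost, written $\xrightarrow{\mathbf{i}}_{\mathcal{P}}$, if all proper subterms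 of $\ell\sigma$ are normal forms. For a relation $\to\subseteq\mathcal{T}\times\mathrm{FDist}(\mathcal{T})$ with normal forms $\mathtt{NF}_\to$, its lifting $\rightrightarrows$ is the smallest relation on $\mathrm{FDist}(\mathcal{T})$ with: $\{1:t\}\rightrightarrows\{1:t\}$ for $t\in\mathtt{NF}_\to$; $\{1:t\}\rightrightarrows\mu$ if $t\to\mu$; and if $\mu_j\rightrightarrows\nu_j$ and $0<p_j\le1$ ($1\le j\le k$) with $\sum_j p_j=1$ then $\bigcup_j p_j\cdot\mu_j\rightrightarrows\bigcup_j p_j\cdot\nu_j$. $|\mu|_\to$ is the sum of probabilities of pairs $(p:t)\in\mu$ with $t\in\mathtt{NF}_\to$. $\mathtt{AST}(\to)$: every infinite sequence $(\mu_n)_n$ with $\mu_n\rightrightarrows\mu_{n+1}$ satisfies $\lim_n|\mu_n|_\to=1$. The expected derivation length of such a sequence is $\mathrm{edl}((\mu_n)_n)=\sum_{n\ge0}(1-|\mu_n|_\to)$. $\mathtt{PAST}(\to)$: $\mathrm{edl}$ is finite for every infinite $\rightrightarrows$-sequence with $\mu_0=\{1:t\}$, $t\in\mathcal{T}$. $\mathrm{edh}_\to(t)=\sup\{\mathrm{edl}(\vec\mu)\mid \vec\mu$ an infinite $\rightrightarrows$-sequence with $\mu_0=\{1:t\}\}$; $\mathtt{SAST}(\to)$: $\mathrm{edh}_\to(t)<\infty$ for all $t\in\mathcal{T}$. $\mathcal{P}$ is non-overlapping if there are no two rules $\ell_1\to\mu_1,\ell_2\to\mu_2\in\mathcal{P}$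 (variables renamed apart) and a non-variable position $\pi$ of $\ell_1$ such that $\ell_1|_\pi$ and $\ell_2$ unify, where $\pi\ne\varepsilon$ is required if both are the same rule. Left-linear: no variable occurs twice in a left-hand side; right-linear: no variable occurs twice in any $r\in\mathrm{Supp}(\mu)$ of a rule $\ell\to\mu$; linear: both; orthogonal: non-overlapping and left-linear. *)

(* Defs.v *)
From HB Require Import structures.
From mathcomp Require Import all_boot all_order all_algebra finmap multiset.
From mathcomp Require Import all_classical all_reals all_analysis.

Set Implicit Arguments.
Unset Strict Implicit.
Unset Printing Implicit Defensive.

Import Order.TTheory GRing.Theory Num.Theory.
Import numFieldNormedType.Exports.

Local Open Scope mset_scope.
Local Open Scope classical_set_scope.
Local Open Scope ring_scope.

Section Terms.

Variables (F : countType) (ar : F -> nat).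

Inductive term (V : Type) : Type :=
| Var of V
| App (f : F) of ('I_(ar f) -> term V).

HB.instance Definition _ (V : Type) := gen_eqMixin (term V).
HB.instance Definition _ (V : Type) := gen_choiceMixin (term V).

Definition is_var V (t : term V) : bool := if t is Var _ then true else false.

Fixpoint subst V W (sigma : V -> term W) (t : term V) : term W :=
  match t with
  | Var x => sigma x
  | App f a => App (fun i => subst sigma (a i))
  end.

Definition rename V W (rho : V -> W) : term V -> term W :=
  subst (fun x => Var (rho x)).

(* The list of variable occurrences, with repetitions, from left to right. *)
Fixpoint vars V (t : term V) : seq V :=
  match t with
  | Var x => [:: x]
  | App f a => flatten [seq vars (a i) | i <- enum 'I_(ar f)]
  end.

(* A position is a sequence of argument indices, counted from 0; it is a      *)
(* position of t exactly when subterm_at t pi is not None.                    *)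
Fixpoint subterm_at V (t : term V) (pi : seq nat) : option (term V) :=
  match pi, t with
  | [::], _ => Some t
  | i :: pi', App f a =>
      if insub i is Some j then subterm_at (a j) pi' else None
  | _ :: _, Var _ => None
  end.

(* t[u]_pi; only meaningful when pi is a position of t. *)
Fixpoint replace_at V (t : term V) (pi : seq nat) (u : term V) : term V :=
  match pi, t with
  | [::], _ => u
  | i :: pi', App f a =>
      App (fun j : 'I_(ar f) =>
             if (j : nat) == i then replace_at (a j) pi' u else a j)
  | _ :: _, Var x => Var x
  end.

Definition unifiable V (t u : term V) : Prop :=
  exists sigma : V -> term V, subst sigma t = subst sigma u.

End Terms.

Notation mdist R A := {mset (R * A)%type}%mset.

Section MultiDistributions.

Variables (R : realType) (A : choiceType).
Implicit Types (mu nu : mdist R A).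

Definition is_fdist mu : Prop :=
  (forall x, x \in mu -> 0 < x.1 <= 1) /\ \sum_(x <- mu) x.1 = 1.

Definition supp mu : {mset A} := seq_mset [seq x.2 | x <- mu].

Definition scale (p : R) mu : mdist R A :=
  seq_mset [seq (p * x.1, x.2) | x <- mu].

Definition pointdist (a : A) : mdist R A := [mset (1, a)]%mset.

Variable step : A -> mdist R A -> Prop.

Definition normal_form (a : A) : Prop := forall mu, ~ step a mu.

Inductive lifting : mdist R A -> mdist R A -> Prop :=
| lifting_nf a : normal_form a -> lifting (pointdist a) (pointdist a)
| lifting_step a mu : step a mu -> lifting (pointdist a) mu
| lifting_union (k : nat) (p : 'I_k -> R) (mu nu : 'I_k -> mdist R A) :
    (forall j, lifting (mu j) (nu j)) ->
    (forall j, 0 < p j <= 1) ->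
    \sum_(j < k) p j = 1 ->
    lifting (\big[@msetD _/mset0]_(j < k) scale (p j) (mu j))
            (\big[@msetD _/mset0]_(j < k) scale (p j) (nu j)).

Definition lifting_seq (mu : nat -> mdist R A) : Prop :=
  (forall n, is_fdist (mu n)) /\ (forall n, lifting (mu n) (mu n.+1)).

Definition nf_mass mu : R := \sum_(x <- mu | `[< normal_form x.2 >]) x.1.

Definition edl (mu : nat -> mdist R A) : \bar R :=
  (\sum_(0 <= n <oo) (1 - nf_mass (mu n))%:E)%E.

Definition edh (a : A) : \bar R :=
  ereal_sup
    [set edl mu | mu in [set mu : nat -> mdist R A |
                           lifting_seq mu /\ mu 0%N = pointdist a]].

Definition AST : Prop :=
  forall mu : nat -> mdist R A, lifting_seq mu -> nf_mass (mu n) @[n --> \oo] --> (1 : R).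

Definition PAST : Prop :=
  forall (mu : nat -> mdist R A) a,
    lifting_seq mu -> mu 0%N = pointdist a -> (edl mu < +oo)%E.

Definition SAST : Prop := forall a, (edh a < +oo)%E.

End MultiDistributions.

Section PTRS.

Variables (R : realType) (F : countType) (ar : F -> nat) (V : countType).

Notation term := (term ar V).

Record prule : Type := PRule {
  lhs : term ;
  rhs : mdist R term }.

Definition is_prule (r : prule) : Prop :=
  [/\ ~~ is_var (lhs r),
      is_fdist (rhs r) &
      forall t, t \in supp (rhs r) -> {subset vars t <= vars (lhs r)}].

Definition is_PTRS (P : set prule) : Prop :=
  countable P /\ (forall r, P r -> is_prule r).

Definition rewrites_with (s : term) (mu : mdist R term)
    (pi : seq nat) (r : prule) (sigma : V -> term) : Prop :=
  subterm_at s pi = Some (subst sigma (lhs r)) /\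
  mu = seq_mset
    [seq (x.1, replace_at s pi (subst sigma x.2)) | x <- rhs r].

Definition full_step (P : set prule) (s : term) (mu : mdist R term) :
    Prop :=
  exists pi r sigma, P r /\ rewrites_with s mu pi r sigma.

Definition innermost_step (P : set prule) (s : term)
    (mu : mdist R term) : Prop :=
  exists pi r sigma, [/\ P r, rewrites_with s mu pi r sigma &
    forall tau u, tau <> [::] ->
      subterm_at (subst sigma (lhs r)) tau = Some u ->
      normal_form (full_step P) u].

(* Variables are renamed apart by passing to terms over V + V. *)
Definition overlap (r1 r2 : prule) : Prop :=
  exists pi t, [/\ subterm_at (lhs r1) pi = Some t, ~~ is_var t,
    r1 = r2 -> pi <> [::] &
    unifiable (rename (@inl V V) t) (rename (@inr V V) (lhs r2))].

Definition non_overlapping (P : set prule) : Prop :=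
  forall r1 r2, P r1 -> P r2 -> ~ overlap r1 r2.

Definition left_linear (P : set prule) : Prop :=
  forall r, P r -> uniq (vars (lhs r)).

Definition right_linear (P : set prule) : Prop :=
  forall r t, P r -> t \in supp (rhs r) -> uniq (vars t).

Definition orthogonal_PTRS (P : set prule) : Prop :=
  non_overlapping P /\ left_linear P.

End PTRS.

(* Main.v *)
(* The innermost strategy is the slowest one. Fix one innermost step for every *)
(* reducible term and let value n t be the probability that the resulting      *)
(* chain started in t is in a normal form after n steps. An innermost step and *)
(* any other step out of t commute: by non-overlappingness and left-linearity  *)
(* the outer redex survives the inner step, and by right-linearity the inner   *)
(* redex has at most one residual after the outer step, which is still         *)
(* innermost; it may have none, in which case the innermost strategy only      *)
(* loses time. Hence value (n + 1) t is at most the mean of value n over the   *)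
(* outcomes of any step out of t, with equality for innermost steps. So along  *)
(* every full rewrite sequence the normal form mass at time n is at least that *)
(* of the chosen innermost sequence at time n, which settles AST, PAST and     *)
(* SAST at once.                                                               *)

Require Import Defs.
From HB Require Import structures.
From mathcomp Require Import all_boot all_order all_algebra finmap multiset.
From mathcomp Require Import all_classical all_reals all_analysis.
From Stdlib Require Eqdep_dec.

Set Implicit Arguments.
Unset Strict Implicit.
Unset Printing Implicit Defensive.

Import Order.TTheory GRing.Theory Num.Theory.
Import numFieldNormedType.Exports.

(** An innermost sequence is itself a full sequence, and both relations have the same normal forms
    ([innermost_NF]); this gives the implications from full to innermost. For the converse, a full
    sequence is compared with the Markov chain of a fixed innermost choice [pick]. The rewriting
    content is [diamond]: an innermost step commutes with any other step, up to erasure.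
    [value_step] turns it into two inequalities by exchanging two expectations, and
    [value_lifting_seq] iterates the first of them along a sequence. The resulting comparison of
    normal form masses yields the three properties through [AST_dominated], [PAST_dominated] and
    [SAST_dominated]. *)

Lemma uniq_flatten_map (I T : eqType) (F : I -> seq T) (s : seq I) :
  uniq (flatten [seq F i | i <- s]) ->
  {in s, forall i, uniq (F i)} /\
  {in s &, forall i j x, x \in F i -> x \in F j -> i = j}.
Proof.
elim: s => [//|k s IHs] /=; rewrite cat_uniq => /and3P[uk /hasPn dis].
move=> /IHs [us inj]; split=> [i|i j].
  by rewrite inE => /orP[/eqP->|/us].
have sep l x : l \in s -> x \in F k -> x \in F l -> False.
  move=> ls xk xl; have /dis /negP : x \in flatten [seq F i | i <- s].
    by apply/flatten_mapP; exists l.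
  exact.
rewrite !inE => /orP[/eqP->|is'] /orP[/eqP->|js] x xi xj //.
- by case: (sep j x).
- by case: (sep i x).
exact: (inj _ _ is' js x).
Qed.

(** * Substitution in linear terms *)

Section Terms.
Variables (F : countType) (ar : F -> nat).
Implicit Types f : F.

(** Constructor equality yields an equality of dependent pairs; as equality of symbols is decidable,
    the second components agree. *)
Lemma App_inj V f (a b : 'I_(ar f) -> term ar V) : App a = App b -> a = b.
Proof.
move=> e; case: e (e) => e _.
apply: (Eqdep_dec.inj_pair2_eq_dec _ _ _ _ _ _ e) => x y.
by case: (eqVneq x y) => [->|/eqP]; [left|right].
Qed.

Lemma mem_vars_App (V : eqType) f (a : 'I_(ar f) -> term ar V) x :
  reflect (exists i, x \in vars (a i)) (x \in vars (App a)).
Proof.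
apply: (iffP flatten_mapP) => [[i _ xi]|[i xi]]; exists i => //.
by rewrite mem_enum.
Qed.

Lemma uniq_vars_arg (V : eqType) f (a : 'I_(ar f) -> term ar V) i :
  uniq (vars (App a)) -> uniq (vars (a i)).
Proof. by move=> /uniq_flatten_map[u _]; apply: u; rewrite mem_enum. Qed.

Lemma uniq_vars_inj (V : eqType) f (a : 'I_(ar f) -> term ar V) i j x :
  uniq (vars (App a)) -> x \in vars (a i) -> x \in vars (a j) -> i = j.
Proof.
by move=> /uniq_flatten_map[_ inj] xi xj; apply: (inj i j _ _ x);
  rewrite ?mem_enum.
Qed.

Lemma eq_in_subst (V : eqType) W (s1 s2 : V -> term ar W) (t : term ar V) :
  {in vars t, s1 =1 s2} -> subst s1 t = subst s2 t.
Proof.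
elim: t => [x|f a IH] e /=; first by apply: e; rewrite inE.
congr App; apply/funext => i; apply: IH => x xi; apply: e.
by apply/mem_vars_App; exists i.
Qed.

Lemma subst_inj_in (V : eqType) W (s1 s2 : V -> term ar W) (t : term ar V) :
  subst s1 t = subst s2 t -> {in vars t, s1 =1 s2}.
Proof.
elim: t => [x /= e y|f a IH /= /App_inj e x]; first by rewrite inE => /eqP->.
by move=> /mem_vars_App[i xi]; apply: (IH i) => //; have := congr1 (@^~ i) e.
Qed.

Lemma subst_comp V W X (s1 : V -> term ar W) (s2 : W -> term ar X)
    (t : term ar V) :
  subst s2 (subst s1 t) = subst (fun x => subst s2 (s1 x)) t.
Proof.
by elim: t => [//|f a IH] /=; congr App; apply/funext => i; apply: IH.
Qed.

(** A step inside the value of a variable is recorded as an update, so a redex above it stays an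
    instance of the same left-hand side. *)
Definition upd (V : eqType) W (sigma : V -> term ar W) x u : V -> term ar W :=
  fun y => if y == x then u else sigma y.

Lemma subst_upd_notin (V : eqType) W (sigma : V -> term ar W) x u t :
  x \notin vars t -> subst (upd sigma x u) t = subst sigma t.
Proof.
move=> xt; apply: eq_in_subst => y yt; rewrite /upd ifN //.
by apply: contraNneq xt => <-.
Qed.

Definition set_arg V f (a : 'I_(ar f) -> term ar V) (j : 'I_(ar f)) u :
    term ar V :=
  App (fun i : 'I_(ar f) => if (i : nat) == j then u else a i).

Lemma subst_upd_App (V : eqType) W (sigma : V -> term ar W) f
    (a : 'I_(ar f) -> term ar V) j x u :
  uniq (vars (App a)) -> x \in vars (a j) ->
  subst (upd sigma x u) (App a) =
  set_arg (fun i => subst sigma (a i)) j (subst (upd sigma x u) (a j)).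
Proof.
move=> ua xj; rewrite /set_arg /=; congr App; apply/funext => i.
case: ifPn => [/eqP/val_inj -> //|/eqP ij].
apply: subst_upd_notin; apply/negP => xi; apply: ij.
by rewrite (uniq_vars_inj ua xi xj).
Qed.

Lemma subterm_at_nil V (t : term ar V) : subterm_at t [::] = Some t.
Proof. by case: t. Qed.

Lemma replace_at_nil V (t u : term ar V) : replace_at t [::] u = u.
Proof. by case: t. Qed.

Lemma subterm_at_arg V f (a : 'I_(ar f) -> term ar V) (j : 'I_(ar f)) pi :
  subterm_at (App a) (val j :: pi) = subterm_at (a j) pi.
Proof. by rewrite /= valK. Qed.

Lemma subterm_at_App V f (a : 'I_(ar f) -> term ar V) i pi u :
  subterm_at (App a) (i :: pi) = Some u ->
  exists2 j : 'I_(ar f), i = j & subterm_at (a j) pi = Some u.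
Proof. by rewrite /=; case: insubP => // j _ <- e; exists j. Qed.

End Terms.

(** * Innermost steps and their commutation with other steps *)

Section Steps.
Variables (R : realType) (F : countType) (ar : F -> nat) (V : countType).
Variable P : set (prule R ar V).
Hypothesis PTRS_P : is_PTRS P.
Hypothesis ortho_P : orthogonal_PTRS P.
Local Notation term := (term ar V).
Implicit Types (sigma tau : V -> term) (s t u y : term) (r : prule R ar V) (b : bool).

Definition innermost_redex t := forall pi u, pi <> [::] ->
  subterm_at t pi = Some u -> normal_form (full_step P) u.

(* [step b t r g]: contracting a redex of [t] with [r] (an innermost one if    *)
(* [b]) replaces [t] by [g y] when the outcome [y] of [rhs r] is drawn.        *)
Definition step b t r (g : term -> term) := exists pi sigma,
  [/\ P r, subterm_at t pi = Some (subst sigma (lhs r)),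
      (b -> innermost_redex (subst sigma (lhs r))) &
      forall y, g y = replace_at t pi (subst sigma y)].

Definition outcome r (g : term -> term) : {mset (R * term)%type}%mset :=
  seq_mset [seq (x.1, g x.2) | x <- rhs r].

Lemma full_stepP t mu :
  full_step P t mu <-> exists r g, step false t r g /\ mu = outcome r g.
Proof.
split=> [[pi [r [sigma [Pr [e ->]]]]]|].
  exists r, (fun y => replace_at t pi (subst sigma y)).
  by split=> //; exists pi, sigma; split.
move=> [r [g [[pi [sigma [Pr e _ ge]]] ->]]]; exists pi, r, sigma.
by do 2?split=> //; congr seq_mset; apply: eq_map => x; rewrite ge.
Qed.

Lemma innermost_stepP t mu :
  innermost_step P t mu <-> exists r g, step true t r g /\ mu = outcome r g.
Proof.
split=> [[pi [r [sigma [Pr [e ->] inn]]]]|].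
  exists r, (fun y => replace_at t pi (subst sigma y)).
  by split=> //; exists pi, sigma; split.
move=> [r [g [[pi [sigma [Pr e /(_ isT) inn ge]]] ->]]]; exists pi, r, sigma.
by split=> //; split=> //; congr seq_mset; apply: eq_map => x; rewrite ge.
Qed.

Lemma step_full b t r g : step b t r g -> step false t r g.
Proof. by move=> [pi [sigma [Pr e _ ge]]]; exists pi, sigma; split. Qed.

Lemma step_NNF b t r g : step b t r g -> ~ normal_form (full_step P) t.
Proof.
move=> /step_full st nf; apply: (nf (outcome r g)); apply/full_stepP.
by exists r, g.
Qed.

Lemma NNF_step t :
  ~ normal_form (full_step P) t -> exists r g, step false t r g.
Proof.
move=> /existsNP[mu /contrapT/full_stepP[r [g [st _]]]].
by exists r, g.
Qed.

Lemma step_root b sigma r : P r ->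
  (b -> innermost_redex (subst sigma (lhs r))) ->
  step b (subst sigma (lhs r)) r (subst sigma).
Proof.
move=> Pr inn; exists [::], sigma.
by split=> //; [rewrite subterm_at_nil|move=> y; rewrite replace_at_nil].
Qed.

Lemma eq_step b t r g h : g =1 h -> step b t r g -> step b t r h.
Proof.
move=> gh [pi [sigma [Pr e inn ge]]]; exists pi, sigma.
by split=> // y; rewrite -gh.
Qed.

Lemma step_arg b f (a : 'I_(ar f) -> term) j r g :
  step b (a j) r g -> step b (App a) r (fun y => set_arg a j (g y)).
Proof.
move=> [pi [sigma [Pr e inn ge]]]; exists (val j :: pi), sigma.
split=> //; first by rewrite subterm_at_arg.
move=> y; rewrite /set_arg /=; congr App; apply/funext => i.
by case: ifP => // /eqP/val_inj ->; rewrite ge.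
Qed.

Lemma step_App b f (a : 'I_(ar f) -> term) r g : step b (App a) r g ->
  (exists sigma, [/\ P r, App a = subst sigma (lhs r),
     b -> innermost_redex (App a) & g =1 subst sigma]) \/
  (exists j g', step b (a j) r g' /\ forall y, g y = set_arg a j (g' y)).
Proof.
move=> [[|i pi] [sigma [Pr e inn ge]]].
  by left; exists sigma; move: e inn => [<-] inn; split.
right; have [j ej e'] := subterm_at_App e.
exists j, (fun y => replace_at (a j) pi (subst sigma y)); split.
  by exists pi, sigma.
move=> y; rewrite ge /= /set_arg ej; congr App; apply/funext => k.
by case: ifP => // /eqP/val_inj ->.
Qed.

Lemma step_Var b x r g : ~ step b (Var ar x) r g.
Proof.
move=> [[|i pi] [sigma [Pr e _ _]]] //.
have [+ _ _] := PTRS_P.2 r Pr; move: e => /= [].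
by case: (lhs r).
Qed.

Lemma NF_arg f (a : 'I_(ar f) -> term) j :
  normal_form (full_step P) (App a) -> normal_form (full_step P) (a j).
Proof.
by move=> nf; apply: contrapT => /NNF_step[r [g /step_arg/step_NNF]].
Qed.

Lemma NF_subterm t u pi : subterm_at t pi = Some u ->
  normal_form (full_step P) t -> normal_form (full_step P) u.
Proof.
elim: pi t => [|i pi IH] [x|f a] //= ; try by move=> [<-].
by case: insubP => // j _ _ /IH + /(NF_arg (j := j)).
Qed.

Lemma innermost_redex_arg f (a : 'I_(ar f) -> term) j :
  innermost_redex (App a) -> normal_form (full_step P) (a j).
Proof.
by move=> /(_ [:: val j] (a j)); apply; rewrite // subterm_at_arg subterm_at_nil.
Qed.

(** Descend into a reducible argument while there is one; the redex finally reached has only normal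
    arguments. *)
Lemma NNF_innermost t :
  ~ normal_form (full_step P) t -> exists r g, step true t r g.
Proof.
elim: t => [x /NNF_step[r [g /step_Var]]|f a IH nnf] //.
have [[j nj]|/forallNP na] := pselect (exists j,
    ~ normal_form (full_step P) (a j)).
  have [r [g st]] := IH j nj; exists r, (fun y => set_arg a j (g y)).
  exact: step_arg.
have [r [g /step_App[]]] := NNF_step nnf; last first.
  by move=> [j [g' [/step_NNF/na]]].
move=> [sigma [Pr e _ _]]; exists r, (subst sigma); rewrite e.
apply: step_root => // _; rewrite -e => -[//|i pi] u _.
by move=> /subterm_at_App[j _ /NF_subterm]; apply; apply: contrapT.
Qed.

Lemma innermost_NF t :
  normal_form (innermost_step P) t <-> normal_form (full_step P) t.
Proof.
split=> nf.
  apply: contrapT => /NNF_innermost[r [g st]]; apply: (nf (outcome r g)).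
  by apply/innermost_stepP; exists r, g.
by move=> mu /innermost_stepP[r [g [/step_NNF/(_ nf)]]].
Qed.

(** The two copies of the variables are disjoint, so the two matching substitutions glue to a single
    unifier over [V + V]. *)
Lemma overlap_match r1 r2 pi t sigma1 sigma2 :
  subterm_at (lhs r1) pi = Some t -> ~~ is_var t -> (r1 = r2 -> pi <> [::]) ->
  subst sigma1 t = subst sigma2 (lhs r2) -> overlap r1 r2.
Proof.
move=> e nv ne es; exists pi, t; split=> //.
pose inl' : term -> Defs.term ar (V + V) := rename inl.
exists (fun z => match z with inl x => inl' (sigma1 x) | inr x => inl' (sigma2 x) end).
rewrite /rename !subst_comp /= -!(subst_comp _ (fun x => Var ar (inl x))).
by rewrite es.
Qed.

(** No redex of [r] starts at a function symbol of [t], so the redex lies in the value of a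
    variable, and by linearity that variable has one occurrence. *)
Lemma step_in_subst b sigma t r g : uniq (vars t) ->
  (forall pi u sigma', subterm_at t pi = Some u -> ~~ is_var u ->
     subst sigma u <> subst sigma' (lhs r)) ->
  step b (subst sigma t) r g ->
  exists x g', [/\ x \in vars t, step b (sigma x) r g' &
    forall y, g y = subst (upd sigma x (g' y)) t].
Proof.
elim: t g => [x|f a IH] g ua nov st.
  by exists x, g; rewrite inE; split=> // y; rewrite /= /upd eqxx.
have [[sigma' [_ e _ _]]|[j [g1 [{}st ge]]]] := step_App st.
  by case: (nov [::] (App a) sigma').
have [||x [g' [xj st' ge']]] := IH j g1 _ _ st.
- exact: uniq_vars_arg ua.
- by move=> pi u sigma' e; apply: (nov (val j :: pi)); rewrite subterm_at_arg.
exists x, g'; split=> //; first by apply/mem_vars_App; exists j.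
by move=> y; rewrite ge (subst_upd_App _ _ ua xj) -ge'.
Qed.

(** Linearity leaves a single copy of the redex, so one step performs the whole update. *)
Lemma step_under_subst b sigma t r g x : uniq (vars t) -> x \in vars t ->
  step b (sigma x) r g ->
  step b (subst sigma t) r (fun y => subst (upd sigma x (g y)) t).
Proof.
move=> + + st; elim: t => [z _|f a IH ua].
  by rewrite inE => /eqP <-; apply: eq_step st => y; rewrite /= /upd eqxx.
move=> /mem_vars_App[j xj].
have st' := IH j (uniq_vars_arg j ua) xj.
apply: eq_step (@step_arg _ _ (fun i => subst sigma (a i)) j _ _ st') => y.
by rewrite (subst_upd_App _ _ ua xj).
Qed.

Lemma set_arg_set_arg f (a : 'I_(ar f) -> term) (i j : 'I_(ar f)) u w : i != j ->
  set_arg (fun k : 'I_(ar f) => if (k : nat) == i then u else a k) j w =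
  set_arg (fun k : 'I_(ar f) => if (k : nat) == j then w else a k) i u.
Proof.
move=> ij; congr App; apply/funext => k; case: eqP => [->|//].
by case: eqP => // e; move: ij; rewrite (val_inj e) eqxx.
Qed.

(* The last alternative is the case where the second step erases the redex of *)
(* the first one.                                                             *)
Lemma diamond b t r1 g1 r2 g2 : step true t r1 g1 -> step b t r2 g2 ->
  (r1 = r2 /\ {in supp (rhs r1), g1 =1 g2}) \/
  exists h : term -> term -> term,
    (forall x, step b (g1 x) r2 (h x)) /\
    (forall y, uniq (vars y) ->
       step true (g2 y) r1 (h^~ y) \/ (~~ b /\ forall x, h x y = g2 y)).
Proof.
elim: t g1 g2 => [x g1 g2 /step_Var //|f a IH g1 g2 st1 st2].
have [[tau [Pr2 e2 inn2 ge2]]|[j [g2' [st2' ge2]]]] := step_App st2; last first.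
  have [[sigma [_ _ /(_ isT) inn _]]|[i [g1' [st1' ge1]]]] := step_App st1.
    by have /(step_NNF st2') := innermost_redex_arg (j := j) inn.
  have [eij|ij] := eqVneq i j; last first.
    (* Disjoint redexes: [h] fills both holes, and the order is irrelevant. *)
    right; exists (fun x y => set_arg
      (fun k : 'I_(ar f) => if (k : nat) == i then g1' x else a k) j (g2' y)).
    split=> [x|y _].
      rewrite ge1; apply: (step_arg (j := j)); rewrite ifN //.
      by rewrite eq_sym.
    left; rewrite ge2.
    apply: (@eq_step _ _ _ (fun x => set_arg
      (fun k : 'I_(ar f) => if (k : nat) == j then g2' y else a k) i (g1' x))).
      by move=> x; rewrite [RHS]set_arg_set_arg.
    by apply: step_arg; rewrite ifN.
  rewrite {i}eij in st1' ge1.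
  have set_argK u w : set_arg
      (fun k : 'I_(ar f) => if (k : nat) == j then u else a k) j w =
      set_arg a j w.
    by congr App; apply/funext => k; case: eqP.
  have [[er eg]|[h [h1 h2]]] := IH j _ _ st1' st2'; [left|right].
    by split=> // y yr; rewrite ge1 ge2 eg.
  exists (fun x y => set_arg a j (h x y)); split=> [x|y uy].
    rewrite ge1; apply: eq_step (step_arg (j := j) _) => [y|].
      exact: set_argK.
    by rewrite eqxx.
  have [st|[nb hE]] := h2 y uy; [left|right]; rewrite ge2.
    apply: eq_step (step_arg (j := j) _) => [x|]; first exact: set_argK.
    by rewrite eqxx.
  by split=> // x; rewrite hE.
have [nv2 _ _] := PTRS_P.2 _ Pr2.
have ul := ortho_P.2 _ Pr2.
case el : (lhs r2) nv2 => [//|f' c] _.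
rewrite e2 el in st1 inn2.
have [[sigma [Pr1 e1 _ ge1]]|[j [g1' [st1' ge1]]]] := step_App st1.
  (* Both redexes are the root: distinct rules would overlap there, and the matching substitution is
     determined on the variables of the left-hand side, hence on those of the outcomes. *)
  left; have er : r1 = r2.
    apply: contrapT => ner; apply: (ortho_P.1 _ _ Pr1 Pr2).
    have [nv1 _ _] := PTRS_P.2 _ Pr1.
    apply: (@overlap_match _ _ [::] (lhs r1) sigma tau) => //.
      by rewrite subterm_at_nil.
    by rewrite -e1 el.
  split=> // y yr; rewrite ge1 ge2; apply: eq_in_subst => x xy.
  have [_ _ sub] := PTRS_P.2 _ Pr1.
  apply: (@subst_inj_in _ _ _ _ _ _ (lhs r1)); last exact: sub xy.
  by rewrite -e1 er el.
case: b {IH} st2 inn2 => [st2 /(_ isT) inn2|st2 _].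
  by have /(step_NNF st1') := innermost_redex_arg (j := j) inn2.
have Pr1 : P r1 by move: st1' => [? [? []]].
rewrite el in ul.
(* An overlap would sit at the nonempty position [val j :: pi], which is excluded even if both rules
   coincide. So the first step happens inside [tau x]. *)
have [||x [g' [xj st ge]]] := step_in_subst _ _ st1'.
- exact: uniq_vars_arg ul.
- move=> pi u sigma e nv es; apply: (ortho_P.1 _ _ Pr2 Pr1).
  apply: (@overlap_match _ _ (val j :: pi) u tau sigma) => //.
  by rewrite el subterm_at_arg.
right; exists (fun u => subst (upd tau x (g' u))); split=> [u|y uy].
  rewrite ge1 ge -(subst_upd_App _ _ ul xj) -el.
  exact: step_root.
rewrite ge2; have [xy|xy] := boolP (x \in vars y); [left|right].
  exact: step_under_subst.
by split=> // u; rewrite subst_upd_notin.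
Qed.

End Steps.

(** * Expectations over multi-distributions, and liftings *)

Section Expectation.
Local Open Scope ring_scope.
Variables (R : realType) (A : choiceType).
Local Notation mdist := {mset (R * A)%type}%mset.
Implicit Types (a : A) (mu nu : mdist) (v w : A -> R) (pick : A -> mdist).

Definition expect v mu : R := \sum_(x <- mu) x.1 * v x.2.

Lemma expect_seq_mset v (s : seq (R * A)) :
  expect v (seq_mset s) = \sum_(x <- s) x.1 * v x.2.
Proof. exact/perm_big/perm_eq_seq_mset. Qed.

Lemma mem_seq_mset (T : choiceType) (s : seq T) : seq_mset s =i s.
Proof. exact/perm_mem/perm_eq_seq_mset. Qed.

Lemma expect_scale v p mu : expect v (scale p mu) = p * expect v mu.
Proof.
by rewrite expect_seq_mset big_map mulr_sumr; under eq_bigr do rewrite -mulrA.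
Qed.

Lemma pointdistE a : pointdist R a = seq_mset [:: (1, a) : (R * A)%type].
Proof. by apply/msetP => x; rewrite mset_seqE msetnE /= addn0 eq_sym; case: eqP. Qed.

Lemma expect_pointdist v a : expect v (@pointdist R A a) = v a.
Proof. by rewrite pointdistE expect_seq_mset big_seq1 mul1r. Qed.

Lemma expect_mset0 v : expect v mset0 = 0.
Proof. exact: big_mset0. Qed.

Lemma msetD_seq_mset (mu nu : mdist) : (mu `+` nu)%mset = seq_mset (mu ++ nu).
Proof. by apply/msetP => x; rewrite mset_seqE count_cat !count_mem_mset msetE2. Qed.

Lemma expect_msetD v mu nu :
  expect v (mu `+` nu)%mset = expect v mu + expect v nu.
Proof. by rewrite msetD_seq_mset expect_seq_mset big_cat. Qed.

Lemma expect_mixture v k (p : 'I_k -> R) (mu : 'I_k -> mdist) :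
  expect v (\big[@msetD _/mset0]_(j < k) scale (p j) (mu j)) =
  \sum_(j < k) p j * expect v (mu j).
Proof.
rewrite (big_morph (expect v) (expect_msetD v) (expect_mset0 v)).
by apply: eq_bigr => j _; rewrite expect_scale.
Qed.

Lemma le_expect v w mu : is_fdist mu ->
  (forall a, a \in supp mu -> v a <= w a) -> expect v mu <= expect w mu.
Proof.
move=> [pos _] vw; rewrite /expect big_seq [leRHS]big_seq; apply: ler_sum => x xmu.
have /andP[p0 _] := pos x xmu; apply: ler_wpM2l; first exact: ltW.
by apply: vw; rewrite mem_seq_mset map_f.
Qed.

Lemma expect_ge0 v mu : is_fdist mu -> (forall a, 0 <= v a) -> 0 <= expect v mu.
Proof.
move=> fmu v0; have <- : expect (fun=> 0) mu = 0.
  by rewrite /expect big1 // => x _; rewrite mulr0.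
exact: le_expect.
Qed.

Lemma expect_cst c mu : is_fdist mu -> expect (fun=> c) mu = c.
Proof. by move=> [_ e]; rewrite /expect -mulr_suml e mul1r. Qed.

Lemma is_fdist_pointdist a : is_fdist (@pointdist R A a).
Proof.
rewrite pointdistE; split=> [x|].
  by rewrite mem_seq_mset inE => /eqP -> /=; rewrite ltr01 lexx.
by rewrite (perm_big _ (perm_eq_seq_mset _)) big_seq1.
Qed.

(** One step of the Markov chain with kernel [pick], written in the shape of [lifting_union]. *)
Definition kernel_step pick mu : mdist :=
  \big[@msetD _/mset0]_(j < size mu)
    scale (tnth (in_tuple mu) j).1 (pick (tnth (in_tuple mu) j).2).

Lemma expect_kernel_step pick v mu :
  expect v (kernel_step pick mu) = expect (fun a => expect v (pick a)) mu.
Proof. by rewrite expect_mixture /expect [RHS]big_tnth. Qed.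

Lemma is_fdist_kernel_step pick mu :
  (forall a, is_fdist (pick a)) -> is_fdist mu -> is_fdist (kernel_step pick mu).
Proof.
move=> fpick fmu; split; last first.
  (* The total mass is the expectation of the constant 1. *)
  have := expect_kernel_step pick (fun=> 1) mu.
  have -> : (fun a => expect (fun=> 1) (pick a)) = (fun=> 1).
    by apply/funext => a; rewrite expect_cst.
  rewrite (expect_cst _ fmu) => <-.
  by apply: eq_bigr => x _; rewrite mulr1.
rewrite /kernel_step.
apply: (big_ind (fun nu : mdist => forall x, x \in nu -> 0 < x.1 <= 1)).
- by move=> x; rewrite in_mset0.
- by move=> nu1 nu2 H1 H2 x; rewrite in_msetD => /orP[/H1|/H2].
move=> j _ x; rewrite mem_seq_mset => /mapP[y ymu ->] /=.
have /andP[p0 p1] : 0 < (tnth (in_tuple mu) j).1 <= 1.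
  by apply: fmu.1; exact: mem_tnth.
have /andP[q0 q1] := (fpick _).1 y ymu.
by rewrite mulr_gt0 // mulr_ile1 // ltW.
Qed.

Lemma mset_mixture mu : mu = kernel_step (@pointdist R A) mu.
Proof.
have e (x : R * A) : scale x.1 (pointdist R x.2) = seq_mset [:: x].
  rewrite pointdistE; apply/eq_seq_msetP.
  apply: perm_trans (perm_map _ (perm_eq_seq_mset _)) _.
  by rewrite /= mulr1; case: x.
rewrite /kernel_step -(big_tnth _ _ _ xpredT (fun x => scale x.1 (pointdist R x.2))).
rewrite -[LHS]seq_mset_id; elim: (enum_mset mu) => [|x s IHs].
  by rewrite big_nil; apply/msetP => y; rewrite mset_seqE mset0E.
rewrite big_cons -IHs e msetD_seq_mset; apply/eq_seq_msetP.
rewrite perm_sym.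
exact: (perm_cat (perm_eq_seq_mset [:: x]) (perm_eq_seq_mset s)).
Qed.

Variable step : A -> mdist -> Prop.

Lemma lifting_kernel_step pick mu : is_fdist mu ->
  (forall a, lifting step (@pointdist R A a) (pick a)) ->
  lifting step mu (kernel_step pick mu).
Proof.
move=> fmu lp; rewrite {1}[mu]mset_mixture; apply: lifting_union => // [j|].
  by apply: fmu.1; exact: mem_tnth.
by have [_ <-] := fmu; rewrite [RHS]big_tnth.
Qed.

(** Expectation is linear in the distribution, so the bounds on single terms pass through
    mixtures. *)
Lemma le_expect_lifting v w mu nu :
  (forall a rho, step a rho -> v a <= expect w rho) ->
  (forall a, normal_form step a -> v a <= w a) ->
  lifting step mu nu -> expect v mu <= expect w nu.
Proof.
move=> vstep vnf; elim=> {mu nu} [a /vnf|a rho /vstep|k p mu nu _ IH p01 _].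
- by rewrite !expect_pointdist.
- by rewrite expect_pointdist.
rewrite !expect_mixture; apply: ler_sum => j _.
by apply: ler_wpM2l => //; have /andP[/ltW] := p01 j.
Qed.

Lemma nf_massE mu :
  nf_mass step mu = expect (fun a => `[< normal_form step a >]%:R) mu.
Proof.
by rewrite /nf_mass big_mkcond; apply: eq_bigr => x _; case: asbool;
  rewrite ?mulr1 ?mulr0.
Qed.

Lemma nf_mass_le1 mu : is_fdist mu -> nf_mass step mu <= 1.
Proof.
move=> fmu; rewrite nf_massE -[leRHS](expect_cst 1 fmu).
by apply: le_expect => // a _; case: asbool; rewrite ?ler01.
Qed.

End Expectation.

(** * Transfer of termination along domination of normal form masses *)

Section Domination.
Local Open Scope ring_scope.
Local Open Scope classical_set_scope.
Variables (R : realType) (A : choiceType).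
Variables (step1 step2 : A -> {mset (R * A)%type}%mset -> Prop).
(** Instantiated in both directions between full and innermost rewriting. The common start matters
    for [PAST] and [SAST], whose sequences begin at a point. *)
Hypothesis dominated : forall mu, lifting_seq step1 mu -> exists nu,
  [/\ lifting_seq step2 nu, nu 0%N = mu 0%N &
      forall n, nf_mass step2 (nu n) <= nf_mass step1 (mu n)].

Lemma AST_dominated : AST step2 -> AST step1.
Proof.
move=> ast mu lmu; have [nu [lnu _ le_nm]] := dominated lmu.
apply: squeeze_cvgr (ast nu lnu) (cvg_cst _).
by apply: nearW => n; rewrite le_nm nf_mass_le1 //; exact: lmu.1.
Qed.

Lemma le_edl mu nu : lifting_seq step1 mu ->
  (forall n, nf_mass step2 (nu n) <= nf_mass step1 (mu n)) ->
  (edl step1 mu <= edl step2 nu)%E.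
Proof.
move=> lmu le_nm; apply: lee_nneseries => n *; rewrite lee_fin.
  by rewrite subr_ge0 nf_mass_le1 //; exact: lmu.1.
by rewrite lerD2l lerN2.
Qed.

Lemma PAST_dominated : PAST step2 -> PAST step1.
Proof.
move=> past mu a lmu mu0; have [nu [lnu nu0 le_nm]] := dominated lmu.
by apply: le_lt_trans (le_edl lmu le_nm) (past nu a lnu _); rewrite nu0.
Qed.

Lemma SAST_dominated : SAST step2 -> SAST step1.
Proof.
move=> sast a; apply: le_lt_trans (sast a).
apply: ge_ereal_sup => _ [mu [lmu mu0] <-].
have [nu [lnu nu0 le_nm]] := dominated lmu.
apply: le_trans (le_edl lmu le_nm) _; apply: ereal_sup_ubound.
by exists nu => //; split=> //; rewrite nu0.
Qed.

End Domination.

(** * Normal form probabilities of the chosen innermost chain *)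

Section Value.
Local Open Scope ring_scope.
Variables (R : realType) (F : countType) (ar : F -> nat) (V : countType).
Variable P : set (prule R ar V).
Hypothesis PTRS_P : is_PTRS P.
Hypothesis ortho_P : orthogonal_PTRS P.
Hypothesis rlin_P : right_linear P.
Local Notation term := (term ar V).
Local Notation mdist := {mset (R * term)%type}%mset.
Local Notation NF := (normal_form (full_step P)).
Implicit Types (t : term) (r : prule R ar V) (g : term -> term).

Lemma expect_outcome (v : term -> R) r g :
  expect v (outcome r g) = expect (v \o g) (rhs r).
Proof. by rewrite expect_seq_mset big_map. Qed.

Lemma is_fdist_outcome r g : P r -> is_fdist (outcome r g).
Proof.
move=> /(PTRS_P.2) [_ [pos sum1] _]; split=> [x|].
  by rewrite mem_seq_mset => /mapP[y /pos + ->].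
by rewrite (perm_big _ (perm_eq_seq_mset _)) big_map.
Qed.

Lemma step_rule b t r g : step P b t r g -> P r.
Proof. by move=> [? [? []]]. Qed.

Variable pick : term -> mdist.
Hypothesis pickP : forall t,
  (NF t /\ pick t = @pointdist R term t) \/ innermost_step P t (pick t).

Lemma is_fdist_pick t : is_fdist (pick t).
Proof.
case: (pickP t) => [[_ ->]|/innermost_stepP[r [g [/step_rule Pr ->]]]].
  exact: is_fdist_pointdist.
exact: is_fdist_outcome.
Qed.

Lemma pick_NF t : NF t -> pick t = @pointdist R term t.
Proof.
by move=> nf; case: (pickP t) => [[]//|/innermost_stepP[r [g [/step_NNF]]]].
Qed.

Lemma pick_step b t r g : step P b t r g ->
  exists r' g', step P true t r' g' /\ pick t = outcome r' g'.
Proof.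
by move=> /step_NNF nnf; case: (pickP t) => [[]//|/innermost_stepP].
Qed.

(** Backward recursion on the first step of the chain; [expect_iter_kernel] links it to the forward
    iteration. *)
Fixpoint value (n : nat) t : R :=
  if n is m.+1 then expect (value m) (pick t) else `[< NF t >]%:R.

Lemma value_ge0 n t : 0 <= value n t.
Proof.
elim: n t => [|n IH] t /=; first exact: ler0n.
by apply: expect_ge0 => //; exact: is_fdist_pick.
Qed.

Lemma value_NF n t : NF t -> value n t = 1.
Proof.
move=> nf; elim: n => [|n IH] /=; first by rewrite asboolT.
by rewrite pick_NF // expect_pointdist.
Qed.

Lemma value0_step b t r g : step P b t r g -> value 0 t = 0.
Proof. by move=> /step_NNF nnf /=; rewrite asboolF. Qed.

(** The chain never leaves a normal form. *)
Lemma value_leS n t : value n t <= value n.+1 t.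
Proof.
elim: n t => [|n IH] t; last first.
  by apply: le_expect => [|u _]; [exact: is_fdist_pick|exact: IH].
have [nf|nnf] := pselect (NF t); first by rewrite !value_NF.
rewrite [leLHS]/= asboolF //; exact: value_ge0.
Qed.

Lemma exchange_expect (v : term -> term -> R) (mu nu : mdist) :
  expect (fun x => expect (v x) nu) mu = expect (fun y => expect (v^~ y) mu) nu.
Proof.
rewrite /expect; under eq_bigr do rewrite mulr_sumr.
rewrite exchange_big /=; apply: eq_bigr => y _.
by rewrite mulr_sumr; apply: eq_bigr => x _; rewrite mulrCA.
Qed.

(* The two bounds are proved simultaneously: postponing the chosen innermost  *)
(* step past another step uses the other bound one level down.                *)
Lemma value_step n :
  (forall t r g, step P false t r g ->
     value n.+1 t <= expect (value n) (outcome r g)) /\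
  (forall t r g, step P true t r g ->
     expect (value n) (outcome r g) <= value n.+1 t).
Proof.
have eq_outcome r1 g1 g2 : {in supp (rhs r1), g1 =1 g2} ->
    outcome r1 g1 = outcome r1 g2.
  move=> e; congr seq_mset; apply/eq_in_map => x xr.
  by rewrite e // mem_seq_mset map_f.
have fdist_rhs r : P r -> is_fdist (rhs r) by move=> /(PTRS_P.2)[].
elim: n => [|n [IHf IHi]]; split=> t r2 g2 st2.
- have [r1 [g1 [st1 /= ->]]] := pick_step st2.
  have [[er eg]|[h [h1 h2]]] := diamond PTRS_P ortho_P st1 st2.
    by rewrite -er (eq_outcome _ _ _ eg).
  (* Each [g1 x] still admits the second step, so the left side is 0. *)
  rewrite [leLHS]expect_outcome.
  apply: le_trans (expect_ge0 _ (value_ge0 0)); last first.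
    exact: is_fdist_outcome (step_rule st2).
  rewrite -[leRHS](expect_cst 0 (fdist_rhs _ (step_rule st1))).
  apply: le_expect => [|x _]; first exact: fdist_rhs (step_rule st1).
  by rewrite -(value0_step (h1 x)).
- have [r1 [g1 [st1 /= e1]]] := pick_step st2; rewrite e1.
  have [[er eg]|[h [_ h2]]] := diamond PTRS_P ortho_P st1 st2.
    by rewrite -er (eq_outcome _ _ _ eg).
  (* Each outcome of the second step still contains the innermost redex, so the left side is 0. *)
  apply: le_trans (expect_ge0 _ (value_ge0 0)); last first.
    exact: is_fdist_outcome (step_rule st1).
  rewrite [leLHS]expect_outcome.
  rewrite -[leRHS](expect_cst 0 (fdist_rhs _ (step_rule st2))).
  apply: le_expect => [|y yr]; first exact: fdist_rhs (step_rule st2).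
  have [st|[]//] := h2 y (rlin_P (step_rule st2) yr).
  by rewrite -(value0_step st).
- have [r1 [g1 [st1 e1]]] := pick_step st2.
  rewrite [leLHS](_ : _ = expect (value n.+1) (pick t)) // e1.
  have [[er eg]|[h [h1 h2]]] := diamond PTRS_P ortho_P st1 st2.
    by rewrite -er (eq_outcome _ _ _ eg).
  have f1 := fdist_rhs _ (step_rule st1).
  have f2 := fdist_rhs _ (step_rule st2).
  rewrite !expect_outcome.
  (* Take the second step inside each [g1 x], exchange the expectations, then absorb the chosen
     innermost step into [value n.+1 (g2 y)]. *)
  apply: (@le_trans _ _ (expect (fun x =>
      expect (value n) (outcome r2 (h x))) (rhs r1))).
    by apply: le_expect => // x _; apply: IHf.
  under eq_fun do rewrite expect_outcome.
  rewrite exchange_expect; apply: le_expect => // y yr.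
  have [st|[_ e]] := h2 y (rlin_P (step_rule st2) yr).
    by have := IHi _ _ _ st; rewrite expect_outcome.
  (* Erased redex: the second step alone already reaches [h x y], with one time unit to spare. *)
  apply: le_trans (value_leS n _).
  rewrite -[leRHS](expect_cst _ f1); apply: le_expect => // x _ /=.
  by rewrite e.
- have [r1 [g1 [st1 e1]]] := pick_step st2.
  rewrite [leRHS](_ : _ = expect (value n.+1) (pick t)) // e1.
  have [[er eg]|[h [h1 h2]]] := diamond PTRS_P ortho_P st1 st2.
    by rewrite -er (eq_outcome _ _ _ eg).
  have f1 := fdist_rhs _ (step_rule st1).
  have f2 := fdist_rhs _ (step_rule st2).
  rewrite !expect_outcome.
  (* The same exchange with reversed inequalities; an innermost second step erases nothing. *)
  apply: (@le_trans _ _ (expect (fun x =>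
      expect (value n) (outcome r2 (h x))) (rhs r1))); last first.
    by apply: le_expect => // x _; apply: IHi.
  under eq_fun do rewrite expect_outcome.
  rewrite exchange_expect; apply: le_expect => // y yr.
  have [st|[]//] := h2 y (rlin_P (step_rule st2) yr).
  by have := IHf _ _ _ (step_full st); rewrite expect_outcome.
Qed.

Lemma nf_mass_value0 (mu : mdist) :
  nf_mass (full_step P) mu = expect (value 0) mu.
Proof. exact: nf_massE. Qed.

(** Each lifting step trades one unit of remaining time without lowering the expectation; [m = 0]
    bounds the mass at time [n]. *)
Lemma value_lifting_seq (mu : nat -> mdist) n m : lifting_seq (full_step P) mu ->
  expect (value (m + n)) (mu 0%N) <= expect (value m) (mu n).
Proof.
move=> [_ lmu]; elim: n m => [|n IH] m; first by rewrite addn0.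
rewrite addnS -addSn; apply: le_trans (IH _) _.
apply: le_expect_lifting (lmu n) => [t rho /full_stepP[r [g [st ->]]]|t nf].
  exact: (value_step m).1.
by rewrite !value_NF.
Qed.

Lemma lifting_pick t : lifting (innermost_step P) (@pointdist R term t) (pick t).
Proof.
case: (pickP t) => [[nf ->]|st]; last exact: lifting_step.
by apply/lifting_nf/innermost_NF.
Qed.

Lemma expect_iter_kernel (mu : mdist) n :
  expect (value 0) (iter n (kernel_step pick) mu) = expect (value n) mu.
Proof.
suff H m : expect (value m) (iter n (kernel_step pick) mu) =
           expect (value (n + m)) mu by rewrite H addn0.
elim: n m => [//|n IH] m; rewrite iterS expect_kernel_step.
by rewrite addSnnS -IH.
Qed.

End Value.

(** * Mutual domination of full and innermost rewriting *)

Section Strategies.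
Local Open Scope ring_scope.
Variables (R : realType) (F : countType) (ar : F -> nat) (V : countType).
Variable P : set (prule R ar V).
Hypothesis PTRS_P : is_PTRS P.

Lemma nf_mass_innermost mu :
  nf_mass (innermost_step P) mu = nf_mass (full_step P) mu.
Proof. by apply: eq_bigl => x; apply: asbool_equiv_eq; exact: innermost_NF. Qed.

(** Liftings keep normal forms fixed, so inclusion of the steps must be paired with equality of the
    normal forms. *)
Lemma lifting_innermost_full mu nu :
  lifting (innermost_step P) mu nu -> lifting (full_step P) mu nu.
Proof.
elim=> {mu nu} [t /(innermost_NF PTRS_P)|t mu|]; first exact: lifting_nf.
  move=> /innermost_stepP[r [g [/step_full st ->]]]; apply: lifting_step.
  by apply/full_stepP; exists r, g.
by move=> *; exact: lifting_union.
Qed.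

Lemma innermost_dominated_by_full mu : lifting_seq (innermost_step P) mu ->
  exists nu, [/\ lifting_seq (full_step P) nu, nu 0%N = mu 0%N &
    forall n, nf_mass (full_step P) (nu n) <= nf_mass (innermost_step P) (mu n)].
Proof.
move=> [fmu lmu]; exists mu; split=> // [|n]; last by rewrite nf_mass_innermost.
by split=> // n; exact: lifting_innermost_full.
Qed.

Lemma full_dominated_by_innermost mu :
  orthogonal_PTRS P -> right_linear P -> lifting_seq (full_step P) mu ->
  exists nu, [/\ lifting_seq (innermost_step P) nu, nu 0%N = mu 0%N &
    forall n, nf_mass (innermost_step P) (nu n) <= nf_mass (full_step P) (mu n)].
Proof.
move=> ortho_P rlin_P lmu.
have /choice[pick pickP] : forall t, exists rho,
    (normal_form (full_step P) t /\ rho = @pointdist R _ t) \/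
    innermost_step P t rho.
  move=> t; have [nf|/(NNF_innermost PTRS_P)[r [g st]]] :=
      pselect (normal_form (full_step P) t).
    by exists (@pointdist R _ t); left.
  by exists (outcome r g); right; apply/innermost_stepP; exists r, g.
(* The chosen innermost chain, started from the same distribution. *)
exists (fun n => iter n (kernel_step pick) (mu 0%N)).
have fnu n : is_fdist (iter n (kernel_step pick) (mu 0%N)).
  elim: n => [|n IH]; first exact: lmu.1.
  by apply: is_fdist_kernel_step => // t; exact: is_fdist_pick pickP t.
split=> // [|n].
  by split=> // n; apply: lifting_kernel_step => // t; exact: lifting_pick.
rewrite nf_mass_innermost !(nf_mass_value0 P pick) expect_iter_kernel.
exact: (value_lifting_seq PTRS_P ortho_P rlin_P pickP n 0 lmu).
Qed.

End Strategies.

Theorem theorem4p2 (R : realType) (F : countType) (ar : F -> nat)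
    (V : countType) (P : set (prule R ar V)) :
  is_PTRS P -> orthogonal_PTRS P -> right_linear P ->
  [/\ AST (full_step P) <-> AST (innermost_step P),
      PAST (full_step P) <-> PAST (innermost_step P) &
      SAST (full_step P) <-> SAST (innermost_step P)].
Proof.
move=> PTRS_P ortho_P rlin_P.
have i2f := innermost_dominated_by_full PTRS_P.
have f2i mu := @full_dominated_by_innermost _ _ _ _ _ PTRS_P mu ortho_P rlin_P.
split; split.
- exact: AST_dominated.
- exact: AST_dominated.
- exact: PAST_dominated.
- exact: PAST_dominated.
- exact: SAST_dominated.
- exact: SAST_dominated.
Qed.
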